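(* Let $m\ge 3$. For every root $(d,e)$ of the $m$-Kronecker quiver $K(m)$ with $\gcd(d,e)=1$ there exists an indecomposable tree module of $K(m)$ with dimension vector $(d,e)$.
   Context: All representations are finite-dimensional over $\mathbb{C}$. $K(m)$ has two vertices $1,2$ and $m$ arrows $\alpha_1,\dots,\alpha_m:1\to 2$. A representation of dimension vector $(d,e)$ consists of vector spaces $V,W$ with $\dim V=d$, $\dim W=e$, and linear maps $X_1,\dots,X_m:V\to W$. A root is the dimension vector of some indecomposable representation, i.e. a nonzero $(d,e)\in\mathbb{N}_0^2$ with $d^2+e^2-mde\le 1$. Tree modules: a basis of $X$ is a set $\mathcal{B}=\mathcal{B}_1\cup\mathcal{B}_2$ with $\mathcal{B}_1$ a basis of $V$ and $\mathcal{B}_2$ a basis of $W$. The coefficient quiver $\Gamma(X,\mathcal{B})$ has vertex set $\mathcal{B}$ and, for every arrow $\alpha_k$, $b\in\mathcal{B}_1$, $b'\in\mathcal{B}_2$, an arrow $b\to b'$ whenever the coefficient of $b'$ in $X_k(b)$ is nonzero. $X$ is a tree module if for some basis $\mathcal{B}$ the underlying (multi)graph of $\Gamma(X,\mathcal{B})$ is a tree. *)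

(* Defs.v *)
From HB Require Import structures.
From mathcomp Require Import all_boot all_order all_algebra.
From mathcomp Require Import reals.
From mathcomp Require Import complex.
Set Implicit Arguments.
Unset Strict Implicit.
Unset Printing Implicit Defensive.
Import GRing.Theory.
Local Open Scope ring_scope.

Record finQuiver := FinQuiver {
  qvertex : finType;
  qarrow : finType;
  qsrc : qarrow -> qvertex;
  qtgt : qarrow -> qvertex }.

Section UnderlyingGraph.
Variable Q : finQuiver.
Implicit Types (x y : qvertex Q) (a : qarrow Q).

(* The edges of the underlying multigraph are the arrows of [Q], so parallel
   arrows stay distinct edges. *)
Definition joins a x y : bool :=
  ((qsrc a == x) && (qtgt a == y)) || ((qsrc a == y) && (qtgt a == x)).

Definition adjacent : rel (qvertex Q) := [rel x y | [exists a, joins a x y]].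

Definition graph_connected : Prop :=
  (0 < #|qvertex Q|)%N /\ forall x y, connect adjacent x y.

(* A walk from [x] is the sequence of its steps: the edge taken and the vertex
   reached. *)
Fixpoint is_walk x (s : seq (qarrow Q * qvertex Q)) : bool :=
  if s is (a, y) :: s' then joins a x y && is_walk y s' else true.

(* Edges are required to be distinct as well as vertices: for length 2 this
   means that a cycle is a pair of parallel edges, and that traversing an edge
   back and forth is not a cycle. *)
Definition is_cycle x (s : seq (qarrow Q * qvertex Q)) : bool :=
  [&& is_walk x s, s != [::], last x (unzip2 s) == x,
      uniq (unzip1 s) & uniq (unzip2 s)].

Definition is_tree : Prop :=
  graph_connected /\ forall x s, ~~ is_cycle x s.

End UnderlyingGraph.

Record kronecker_rep (F : fieldType) (m : nat) := KroneckerRep {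
  rep1 : vectType F;
  rep2 : vectType F;
  repmap : 'I_m -> 'Hom(rep1, rep2) }.

Section KroneckerRep.
Variables (F : fieldType) (m : nat).
Implicit Type X : kronecker_rep F m.

Definition has_dimension_vector X (d e : nat) : Prop :=
  \dim {: rep1 X} = d /\ \dim {: rep2 X} = e.

Definition is_subrep X (U : {vspace rep1 X}) (U' : {vspace rep2 X}) : Prop :=
  forall k : 'I_m, (repmap X k @: U <= U')%VS.

Definition is_direct_sum (V : vectType F) (A B : {vspace V}) : Prop :=
  (A + B = fullv)%VS /\ (A :&: B = 0)%VS.

Definition indecomposable X : Prop :=
  ~ has_dimension_vector X 0 0 /\
  forall (U1 U2 : {vspace rep1 X}) (U1' U2' : {vspace rep2 X}),
    is_subrep U1 U1' -> is_subrep U2 U2' ->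
    is_direct_sum U1 U2 -> is_direct_sum U1' U2' ->
    (U1 = 0%VS /\ U1' = 0%VS) \/ (U2 = 0%VS /\ U2' = 0%VS).

Section CoefficientQuiver.
Variables (X : kronecker_rep F m) (p q : nat).
Variables (B1 : p.-tuple (rep1 X)) (B2 : q.-tuple (rep2 X)).

(* [(k, i, j)] stands for a potential arrow [B1_i -> B2_j] coming from the
   [k]-th arrow of the Kronecker quiver. *)
Definition nonzero_coef (t : 'I_m * 'I_p * 'I_q) : bool :=
  let: (k, i, j) := t in coord B2 j (repmap X k (tnth B1 i)) != 0.

Definition coefficient_quiver : finQuiver :=
  @FinQuiver ('I_p + 'I_q)%type {t : 'I_m * 'I_p * 'I_q | nonzero_coef t}
    (fun t => inl (val t).1.2) (fun t => inr (val t).2).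

End CoefficientQuiver.

Definition tree_module X : Prop :=
  exists (B1 : (\dim {: rep1 X}).-tuple (rep1 X))
         (B2 : (\dim {: rep2 X}).-tuple (rep2 X)),
    [/\ basis_of fullv B1, basis_of fullv B2
      & is_tree (coefficient_quiver B1 B2)].

End KroneckerRep.

Definition is_root (F : fieldType) (m d e : nat) : Prop :=
  exists X : kronecker_rep F m, indecomposable X /\ has_dimension_vector X d e.

(* Main.v *)
Require Import Defs.
From HB Require Import structures.
From mathcomp Require Import all_boot all_order all_algebra.
From mathcomp Require Import reals.
From mathcomp Require Import complex.
From mathcomp Require Import zify.
Set Implicit Arguments.
Unset Strict Implicit.
Unset Printing Implicit Defensive.
Import GRing.Theory.
Local Open Scope ring_scope.

(** Up to duality d <= e.  If e > (m-1)d > 0, a reflection functor (the kernel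
    of the map V^m -> W given by the X_k) replaces an indecomposable of
    dimension vector (d,e) by one of dimension vector (md-e,d), which is
    smaller.  This stops either at the simple (0,1) or at some (d,e) with
    0 < d <= e <= (m-1)d, where a caterpillar whose edges at each vertex have
    different colours gives an indecomposable tree module.  Then one reflects
    back.  Let U -> V^m be the map of a tree module, and suppose that the image
    of each basis vector u_j of U involves a basis vector (k_j,v_j) of V^m not
    occurring in the image of any other u_i.  The remaining basis vectors of
    V^m form a basis of the cokernel W of U -> V^m, and for it the difference
    between the numbers of arrows and of vertices of the coefficient quiver is
    unchanged.  The conditions on colours that allow this elimination are
    inherited by V -> W.  Finally, the coefficient quiver of an indecomposable
    is connected, so it is a tree as soon as it has fewer arrows than
    vertices. *)

(** * Trees and incidence matrices *)

Section TreeCriterion.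
Variable Q : finQuiver.
Implicit Types (x y : qvertex Q) (a : qarrow Q).

Lemma adjacent_sym : symmetric (@adjacent Q).
Proof.
by move=> x y; apply/existsP/existsP => -[a]; rewrite /joins orbC => xy; exists a.
Qed.

Definition incidence_mx : 'M[rat]_(#|qarrow Q|, #|qvertex Q|) :=
  \matrix_(a, x) ((enum_val x == qtgt (enum_val a))%:R
                  - (enum_val x == qsrc (enum_val a))%:R).

Definition vertex_row x : 'rV[rat]_#|qvertex Q| :=
  \row_y (enum_val y == x)%:R.

Lemma row_incidence a :
  row (enum_rank a) incidence_mx = vertex_row (qtgt a) - vertex_row (qsrc a).
Proof. by apply/rowP=> y; rewrite !mxE enum_rankK. Qed.

Lemma vertex_rowM x (u : 'cV[rat]_#|qvertex Q|) :
  (vertex_row x *m u) 0 0 = u (enum_rank x) 0.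
Proof.
rewrite mxE (bigD1 (enum_rank x)) //= mxE enum_rankK eqxx mul1r big1 ?addr0 //.
move=> y; rewrite -(inj_eq enum_val_inj) enum_rankK => /negPf yx.
by rewrite mxE yx mul0r.
Qed.

(* Vectors in the kernel are constant along edges, hence constant. *)
Lemma rank_incidence : graph_connected Q -> (#|qvertex Q| <= (\rank incidence_mx).+1)%N.
Proof.
case=> card_gt0 conn.
suff: (\rank (kermx incidence_mx^T) <= 1)%N.
  by rewrite mxrank_ker mxrank_tr leq_subLR addn1.
have [x0 _] : exists x, x \in qvertex Q by apply/card_gt0P.
suff ker_const : (kermx incidence_mx^T <= (const_mx 1 : 'rV[rat]_#|qvertex Q|))%MS.
  exact: leq_trans (mxrankS ker_const) (rank_leq_row _).
apply/rV_subP => u /sub_kermxP uM0.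
  have u_adj x y : adjacent x y -> u 0 (enum_rank x) = u 0 (enum_rank y).
    case/existsP=> a ja.
    have: (u *m incidence_mx^T) 0 (enum_rank a) = 0 by rewrite uM0 mxE.
    have -> : (u *m incidence_mx^T) 0 (enum_rank a)
              = u 0 (enum_rank (qtgt a)) - u 0 (enum_rank (qsrc a)).
      have -> : (u *m incidence_mx^T) 0 (enum_rank a)
              = (row (enum_rank a) incidence_mx *m u^T) 0 0.
        by rewrite !mxE; apply: eq_bigr => i _; rewrite !mxE mulrC.
      rewrite row_incidence mulmxBl [LHS]mxE [X in _ + X]mxE !vertex_rowM.
      by rewrite !mxE.
    move/eqP; rewrite subr_eq0 => /eqP uts.
    by case/orP: ja => /andP[/eqP<- /eqP<-].
  have u_const x : u 0 (enum_rank x) = u 0 (enum_rank x0).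
    have /connectP[s ps ->] := conn x0 x.
    elim: s x0 ps => //= y s IH z /andP[zy ps].
    by rewrite IH // (u_adj _ _ zy).
  apply/sub_rVP; exists (u 0 (enum_rank x0)); apply/rowP=> y.
  by rewrite !mxE mulr1 -(u_const (enum_val y)) enum_valK.
Qed.

(** The signed rows of the traversed edges telescope. As the edges are distinct, no coefficients
    cancel, so the support of [c] is exactly the set of edges used. *)
Lemma walk_incidence x (s : seq (qarrow Q * qvertex Q)) :
    is_walk x s -> uniq (unzip1 s) ->
  exists2 c : 'rV[rat]_#|qarrow Q|,
    c *m incidence_mx = vertex_row (last x (unzip2 s)) - vertex_row x
    & forall a, (c 0 (enum_rank a) != 0) = (a \in unzip1 s).
Proof.
elim: s x => [|[a y] s IH] x /=.
  by exists 0; [rewrite mul0mx subrr | move=> a; rewrite mxE eqxx].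
case/andP=> ja ws /andP[as_ us]; have [c cE cN] := IH _ ws us.
have [e [e0 eE]] : exists e : rat, e != 0 /\
    e *: row (enum_rank a) incidence_mx = vertex_row y - vertex_row x.
  case/orP: ja => /andP[/eqP<- /eqP<-].
    by exists 1; rewrite oner_eq0 scale1r row_incidence.
  by exists (-1); rewrite oppr_eq0 oner_eq0 scaleN1r row_incidence opprB.
exists (c + e *: delta_mx 0 (enum_rank a)).
  by rewrite mulmxDl cE -scalemxAl -rowE eE addrA subrK.
move=> b; rewrite !mxE eqxx /= (inj_eq enum_rank_inj) inE.
case: (eqVneq b a) => [->|_]; last by rewrite mulr0 addr0 cN.
have /eqP-> : c 0 (enum_rank a) == 0 by apply: contraNT as_; rewrite cN.
by rewrite mulr1 add0r.
Qed.

(* The rows of the incidence matrix are then independent, whereas a cycle is a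
   linear relation between them. *)
Lemma is_tree_card_arrows :
  graph_connected Q -> (#|qarrow Q| < #|qvertex Q|)%N -> is_tree Q.
Proof.
move=> conn lt_av; split=> // x s; apply/negP => /and5P[ws s0 /eqP lx us _].
have free_inc : row_free incidence_mx.
  rewrite /row_free eqn_leq rank_leq_row /= -ltnS.
  exact: leq_trans lt_av (rank_incidence conn).
have [c cE cN] := walk_incidence ws us.
have c0 : c = 0.
  by apply: (row_free_inj free_inc); rewrite cE lx subrr mul0mx.
case: s s0 {ws lx us cE} cN => [|[a y] s] // _ /(_ a).
by rewrite c0 mxE eqxx inE eqxx.
Qed.

End TreeCriterion.

(** * Indecomposability in terms of matrices *)

Section IndecMx.
Variables (F : fieldType) (m : nat).

(** Direct sum decompositions correspond to idempotent endomorphisms [(P, Q)]. Matrices act on row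
    vectors from the right, so [A k] is a map F^p -> F^q. *)
Definition indec_mx p q (A : 'I_m -> 'M[F]_(p, q)) : Prop :=
  (0 < p + q)%N /\
  forall (P : 'M_p) (Q : 'M_q), P *m P = P -> Q *m Q = Q ->
    (forall k, P *m A k = A k *m Q) ->
    (P = 0 /\ Q = 0) \/ (P = 1%:M /\ Q = 1%:M).

Lemma indec_mx_tr p q (A : 'I_m -> 'M[F]_(p, q)) :
  indec_mx A -> indec_mx (fun k => (A k)^T).
Proof.
case=> pq0 indA; split=> [|Q P QQ PP QA]; first by rewrite addnC.
have [] := indA P^T Q^T.
- by rewrite -trmx_mul PP.
- by rewrite -trmx_mul QQ.
- by move=> k; apply: trmx_inj; rewrite !trmx_mul !trmxK QA.
- by case=> P0 Q0; left; split; apply: trmx_inj; rewrite ?P0 ?Q0 trmx0.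
- by case=> P1 Q1; right; split; apply: trmx_inj; rewrite ?P1 ?Q1 trmx1.
Qed.

Lemma idempotent_direct_sum (V : vectType F) (f : 'End(V)) :
  (forall v, f (f v) = f v) -> is_direct_sum (limg f) (lker f).
Proof.
move=> ff; split; last first.
  apply/eqP; rewrite -subv0; apply/subvP => v; rewrite memv_cap memv0 memv_ker.
  by case/andP=> /memv_imgP[u _ ->]; rewrite ff.
apply/eqP; rewrite eqEsubv subvf /=; apply/subvP => v _.
rewrite -[v](subrK (f v)) addrC memv_add ?memv_img ?memvf //.
by rewrite memv_ker linearB /= ff subrr.
Qed.

(** In chosen bases, an idempotent endomorphism splits [X] into its image and its kernel. It is zero
    if the image vanishes and the identity if the kernel does. *)
Lemma indecomposable_indec_mx (X : kronecker_rep F m) :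
  indecomposable X ->
  exists A : 'I_m -> 'M[F]_(\dim {: rep1 X}, \dim {: rep2 X}), indec_mx A.
Proof.
case=> dim0 indX.
set e := vbasis {: rep1 X}; set e' := vbasis {: rep2 X}.
have be : basis_of {: rep1 X} e by apply: vbasisP.
have be' : basis_of {: rep2 X} e' by apply: vbasisP.
exists (fun k => passmx.mxof e e' (repmap X k)); split.
  by rewrite lt0n addn_eq0; apply/negP => /andP[/eqP d0 /eqP d'0]; apply: dim0.
move=> P Q PP QQ PA.
pose f := passmx.hommx e e P; pose g := passmx.hommx e' e' Q.
have fP : passmx.mxof e e f = P by rewrite passmx.hommxK.
have gQ : passmx.mxof e' e' g = Q by rewrite passmx.hommxK.
have ff v : f (f v) = f v by rewrite -comp_lfunE -passmx.hommx_mul ?PP.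
have gg v : g (g v) = g v by rewrite -comp_lfunE -passmx.hommx_mul ?QQ.
have fA k v : repmap X k (f v) = g (repmap X k v).
  rewrite -!comp_lfunE; congr (fun_of_lfun _ v).
  apply: (can_inj (passmx.mxofK be be')).
  by rewrite (passmx.mxof_comp _ _ be) (passmx.mxof_comp _ _ be') fP gQ PA.
have [] := indX (limg f) (lker f) (limg g) (lker g).
- move=> k; apply/subvP => _ /memv_imgP[_ /memv_imgP[v _ ->] ->].
  by rewrite fA memv_img ?memvf.
- move=> k; apply/subvP => _ /memv_imgP[v + ->].
  by rewrite !memv_ker -fA => /eqP->; rewrite linear0.
- exact: idempotent_direct_sum.
- exact: idempotent_direct_sum.
- have img0 (V : vectType F) (h : 'End(V)) : limg h = 0%VS -> h = 0.
    move=> h0; apply/lfunP => v; rewrite zero_lfunE.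
    by apply/eqP; rewrite -memv0 -h0 memv_img ?memvf.
  case=> /img0 f0 /img0 g0; left.
  by rewrite -fP -gQ; split; apply/eqP; rewrite passmx.mxof_eq0 ?f0 ?g0.
- have ker0 (V : vectType F) (h : 'End(V)) :
      (forall v, h (h v) = h v) -> lker h = 0%VS -> h = \1%VF.
    move=> hh /eqP/lker0P h_inj; apply/lfunP => v.
    by rewrite id_lfunE; apply: h_inj.
  case=> /(ker0 _ _ ff) f1 /(ker0 _ _ gg) g1; right.
  by rewrite -fP -gQ f1 g1 !passmx.mxof1 ?(basis_free be) ?(basis_free be').
Qed.

Definition mx_rep p q (A : 'I_m -> 'M[F]_(p, q)) : kronecker_rep F m :=
  @KroneckerRep F m 'rV[F]_p 'rV[F]_q (fun k => linfun (mulmxr (A k))).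

Lemma repmap_mx_rep p q (A : 'I_m -> 'M[F]_(p, q)) k u :
  repmap (mx_rep A) k u = u *m A k.
Proof. by rewrite lfunE. Qed.

Lemma dimv_rV n : \dim {: 'rV[F]_n} = n.
Proof. by rewrite dimvf dim_matrix; apply: mul1n. Qed.

Lemma mx_rep_indecomposable p q (A : 'I_m -> 'M[F]_(p, q)) :
  indec_mx A -> indecomposable (mx_rep A).
Proof.
case=> pq0 indA; split=> [[]|U1 U2 U1' U2' sub1 sub2 [U12 cap] [U12' cap']].
  by rewrite !dimv_rV => p0 q0; rewrite p0 q0 in pq0.
(* The projections onto the first summand along the second commute with the maps, since both
   summands are subrepresentations. *)
pose f := daddv_pi U1 U2; pose g := daddv_pi U1' U2'.
pose P : 'M_p := lin1_mx f; pose Q : 'M_q := lin1_mx g.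
have fE (u : 'rV_p) : u *m P = f u by rewrite mul_rV_lin1.
have gE (u : 'rV_q) : u *m Q = g u by rewrite mul_rV_lin1.
have kill2 (V : vectType F) (A1 A2 : {vspace V}) v :
    (A1 :&: A2 = 0)%VS -> v \in A2 -> daddv_pi A1 A2 v = 0.
  move=> capA vA2; have capA' : (A2 :&: A1 = 0)%VS by rewrite capvC.
  have := daddv_pi_add capA (subvP (addvSr A1 A2) _ vA2).
  by rewrite (daddv_pi_id capA' vA2) => /(canRL (addrK _)); rewrite subrr.
have [] := indA P Q.
- by apply/row_matrixP => i; rewrite !rowE mulmxA !fE daddv_pi_proj.
- by apply/row_matrixP => i; rewrite !rowE mulmxA !gE daddv_pi_proj.
- move=> k; apply/row_matrixP => i; rewrite !rowE !mulmxA fE gE.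
  move: (delta_mx 0 i) => u.
  have /memv_addP[u1 u1U [u2 u2U ->]] : u \in (U1 + U2)%VS by rewrite U12 memvf.
  rewrite linearD /= (daddv_pi_id cap) // kill2 // addr0 mulmxDl linearD /=.
  rewrite (daddv_pi_id cap') ?kill2 ?addr0 // -repmap_mx_rep.
    by apply: (subvP (sub2 k)); rewrite memv_img.
  by apply: (subvP (sub1 k)); rewrite memv_img.
- case=> P0 Q0; left; split; apply/eqP; rewrite -subv0; apply/subvP => u uU.
    by rewrite memv0 -(daddv_pi_id cap uU) -[X in X == _]fE P0 mulmx0.
  by rewrite memv0 -(daddv_pi_id cap' uU) -[X in X == _]gE Q0 mulmx0.
case=> P1 Q1; right; split; apply/eqP; rewrite -subv0; apply/subvP => u uU.
  by rewrite memv0 -(mulmx1 u) -P1 fE kill2.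
by rewrite memv0 -(mulmx1 u) -Q1 gE kill2.
Qed.

(** * Reflection functors *)

(* The hypotheses say that 0 -> F^p -> (F^q)^m -> F^r -> 0, with the maps given
   by the Y k and the X k, is exact. *)
Lemma indec_mx_reflect p q r (Y : 'I_m -> 'M[F]_(p, q)) (X : 'I_m -> 'M[F]_(q, r)) :
    \sum_k Y k *m X k = 0 ->
    (forall n (Z : 'I_m -> 'M_(n, q)), \sum_k Z k *m X k = 0 ->
       exists U, forall k, Z k = U *m Y k) ->
    (forall n (U : 'M_(n, p)), (forall k, U *m Y k = 0) -> U = 0) ->
    (forall n (T : 'M_(r, n)), (forall k, X k *m T = 0) -> T = 0) ->
  indec_mx Y -> indec_mx X.
Proof.
move=> YX exact injY surjX [pq0 indY]; split.
  rewrite addn_gt0; case: (posnP q) => // q0; move: pq0.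
  rewrite q0 addn0 => p0; have : (1%:M : 'M[F]_p) = 0.
    by apply: injY => k; apply/matrixP => i [j j_q]; exfalso; move: j_q; rewrite q0.
  by move/matrixP/(_ (Ordinal p0) (Ordinal p0))/eqP; rewrite !mxE eqxx oner_eq0.
move=> P Q PP QQ PX.
(* Applied in each of the m copies of F^q, [P] preserves the kernel F^p and restricts there to [U],
   so that [(U, P)] is an endomorphism of [Y]. *)
have [U UY] : exists U, forall k, Y k *m P = U *m Y k.
  apply: exact; rewrite (eq_bigr (fun k => Y k *m X k *m Q)).
    by rewrite -mulmx_suml YX mul0mx.
  by move=> k _; rewrite -!mulmxA PX.
have UU : U *m U = U.
  apply/eqP; rewrite -subr_eq0; apply/eqP/injY => k.
  by rewrite mulmxBl -mulmxA -UY mulmxA -UY -mulmxA PP subrr.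
have [] := indY U P UU PP.
- by move=> k; rewrite UY.
- case=> U0 P0; left; split=> //; apply: surjX => k.
  by rewrite -PX P0 mul0mx.
- case=> U1 P1; right; split=> //; apply/eqP; rewrite -subr_eq0.
  by apply/eqP/surjX => k; rewrite mulmxBr -PX P1 mul1mx mulmx1 subrr.
Qed.

End IndecMx.

(** * Kernels of the maps (F^q)^m -> F^r *)

Section Descent.
Variables (F : fieldType) (m q : nat).
Local Notation T := ('I_m * 'I_q)%type.

Definition stack_mx r (X : 'I_m -> 'M[F]_(q, r)) : 'M[F]_(#|{: T}|, r) :=
  \matrix_(t, s) X (enum_val t).1 (enum_val t).2 s.

Definition unstack_mx p (Y : 'M[F]_(p, #|{: T}|)) (k : 'I_m) : 'M[F]_(p, q) :=
  \matrix_(i, j) Y i (enum_rank (k, j)).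

Lemma stack_mxM r n (X : 'I_m -> 'M_(q, r)) (U : 'M_(r, n)) :
  stack_mx X *m U = stack_mx (fun k => X k *m U).
Proof.
by apply/matrixP => t s; rewrite !mxE; apply: eq_bigr => i _; rewrite !mxE.
Qed.

Lemma stack_mx_inj r (X Z : 'I_m -> 'M_(q, r)) :
  stack_mx X = stack_mx Z -> X =1 Z.
Proof.
move=> XZ k; apply/matrixP => j s.
by move/matrixP/(_ (enum_rank (k, j)) s): XZ; rewrite !mxE enum_rankK.
Qed.

Lemma mul_stack_mx p r (Y : 'M_(p, #|{: T}|)) (X : 'I_m -> 'M_(q, r)) :
  Y *m stack_mx X = \sum_k unstack_mx Y k *m X k.
Proof.
apply/matrixP => i s; rewrite mxE summxE.
under [RHS]eq_bigr => k _ do rewrite mxE.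
rewrite pair_big /= (reindex enum_rank) /=; last first.
  by apply: onW_bij; apply: enum_rank_bij.
by apply: eq_bigr => -[k j] _; rewrite !mxE enum_rankK.
Qed.

Lemma unstack_mxM p n (U : 'M_(n, p)) (Y : 'M_(p, #|{: T}|)) k :
  unstack_mx (U *m Y) k = U *m unstack_mx Y k.
Proof.
by apply/matrixP => i j; rewrite !mxE; apply: eq_bigr => h _; rewrite !mxE.
Qed.

Lemma unstack_mx_inj p (Y Z : 'M_(p, #|{: T}|)) :
  unstack_mx Y =1 unstack_mx Z -> Y = Z.
Proof.
move=> YZ; apply/matrixP => i t; rewrite -(enum_valK t).
by case: (enum_val t) => k j; have /matrixP/(_ i j) := YZ k; rewrite !mxE.
Qed.

(** A projection of F^r onto the image of the stacked map, paired with the identity of F^q, is an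
    idempotent endomorphism. It is nonzero as q > 0, hence it is the identity. *)
Lemma indec_mx_stack_full r (X : 'I_m -> 'M[F]_(q, r)) :
  (0 < q)%N -> indec_mx X -> row_full (stack_mx X).
Proof.
move=> q0 [_ indX]; set B := stack_mx X.
have BQ : B *m (pinvmx B *m B) = B by rewrite mulmxA mulmxKpV.
have [||k||[_ Q1]] := indX 1%:M (pinvmx B *m B).
- by rewrite mulmx1.
- by rewrite -mulmxA BQ.
- by rewrite mul1mx; apply: (stack_mx_inj (Z := fun k => X k *m _)); rewrite -stack_mxM.
- by case=> /matrixP/(_ (Ordinal q0) (Ordinal q0))/eqP; rewrite !mxE eqxx oner_eq0.
- by apply/row_fullP; exists (pinvmx B).
Qed.

(** [Y] is the kernel of (F^q)^m -> F^r. It inherits indecomposability through [indec_mx_reflect]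
    applied to the dual exact sequence 0 -> F^r -> (F^q)^m -> F^p -> 0, whose maps are the
    transposes. *)
Lemma indec_mx_descend r (X : 'I_m -> 'M[F]_(q, r)) :
    (0 < q)%N -> indec_mx X ->
  exists p (Y : 'I_m -> 'M[F]_(p, q)), (p + r = m * q)%N /\ indec_mx Y.
Proof.
move=> q0 indX; have fullX := indec_mx_stack_full q0 indX.
set B := stack_mx X in fullX; set Y := row_base (kermx B).
exists (\rank (kermx B)), (unstack_mx Y); split.
  have rB : \rank B = r by apply/eqP.
  by rewrite mxrank_ker rB subnK -?{1}rB ?rank_leq_row // card_prod !card_ord.
have YB : Y *m B = 0 by apply/sub_kermxP; rewrite eq_row_base.
have := indec_mx_tr indX.
move/(@indec_mx_reflect F m r q _ _ (fun k => (unstack_mx Y k)^T)) => reflX.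
suff /indec_mx_tr [pq ind] : indec_mx (fun k => (unstack_mx Y k)^T).
  by split=> // P Q PP QQ PQ; apply: ind => // k; rewrite trmxK.
apply: reflX.
- under eq_bigr => k _ do rewrite -trmx_mul.
  by rewrite -linear_sum -mul_stack_mx YB linear0.
- move=> n Z YZ; pose S := stack_mx (fun k => (Z k)^T).
  have YS : Y *m S = 0.
    rewrite mul_stack_mx; apply: trmx_inj; rewrite linear_sum trmx0 -[RHS]YZ.
    by apply: eq_bigr => k _; rewrite /= trmx_mul trmxK.
  have BS : B *m (pinvmx B *m S) = S.
    apply/eqP; rewrite -subr_eq0 -opprB oppr_eq0 mulmxA -{1}[S]mul1mx -mulmxBl.
    (* This matrix has its rows in the left kernel of [B], so it factors through [Y] and annihilates
       [S]. *)
    have /submxP[D ->] : (1%:M - B *m pinvmx B <= Y)%MS.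
      rewrite eq_row_base; apply/sub_kermxP.
      by rewrite mulmxBl mul1mx mulmxKpV ?subrr.
    by rewrite -mulmxA YS mulmx0.
  exists (pinvmx B *m S)^T => k; apply: trmx_inj; rewrite trmx_mul !trmxK.
  move: BS; rewrite stack_mxM => /stack_mx_inj/(_ k) ->.
  by [].
- move=> n U UX; apply: trmx_inj; apply: (row_full_inj fullX).
  rewrite trmx0 mulmx0 stack_mxM; apply/matrixP => t s.
  by rewrite mxE -[X _]trmxK -trmx_mul UX !mxE.
- move=> n U UY; apply: trmx_inj; apply: (row_free_inj (row_base_free (kermx B))).
  rewrite trmx0 mul0mx; apply: unstack_mx_inj => k.
  rewrite unstack_mxM; apply: trmx_inj; rewrite trmx_mul trmxK UY.
  by apply/matrixP => i j; rewrite !mxE.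
Qed.

End Descent.

(** * Reflection of tree modules *)

Lemma ord_avoid2 m (k1 k2 : 'I_m) :
  (3 <= m)%N -> exists k : 'I_m, (k != k1) && (k != k2).
Proof.
move=> m3; have /set0Pn[k] : [set~ k1] :\ k2 != set0.
  rewrite -card_gt0; have := cardsD1 k2 [set~ k1]; rewrite cardsC1 card_ord.
  by case: (k2 \in _) => /=; lia.
by rewrite !inE andbC => kk; exists k.
Qed.

Section ReflectTree.
Variables (F : fieldType) (m : nat).

Definition nb_arrows p q (A : 'I_m -> 'M[F]_(p, q)) : nat :=
  \sum_k \sum_i \sum_j (A k i j != 0%R).

(* Arrow index k : 'I_m is the colour of an arrow.  In order: at every sink the
   incoming arrows have distinct colours; every source has an outgoing arrow
   whose colour no other arrow leaving it has; every sink misses some incoming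
   colour. *)
Definition reflectable p q (A : 'I_m -> 'M[F]_(p, q)) : Prop :=
  [/\ forall k i i' j, A k i j != 0 -> A k i' j != 0 -> i = i',
      forall i, exists t : 'I_m * 'I_q, forall j, (A t.1 i j != 0) = (j == t.2),
      forall j, exists k, forall i, A k i j = 0
    & (nb_arrows A < p + q)%N].

Section Reflection.
Variables (p q : nat) (A : 'I_m -> 'M[F]_(p, q)) (el : 'I_p -> 'I_m * 'I_q).
Hypothesis sink_inj : forall k i i' j, A k i j != 0 -> A k i' j != 0 -> i = i'.
Hypothesis elP : forall i j, (A (el i).1 i j != 0) = (j == (el i).2).

(* A basis of the cokernel of F^p -> (F^q)^m: the pairs (colour, sink) that are
   not eliminated. *)
Let S : {set 'I_m * 'I_q} := ~: [set el i | i : 'I_p].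
Let a (i : 'I_p) : F := A (el i).1 i (el i).2.

(** Row v of colour k is the class of the basis vector [(k, v)] in the cokernel: itself if kept; if
    it is [el i], the combination of kept vectors obtained by solving the relation that the image of
    the i-th basis vector vanishes. *)
Definition reflect_mx (k : 'I_m) : 'M[F]_(q, #|S|) :=
  \matrix_(v, x) ((enum_val x == (k, v))%:R
    - \sum_i (el i == (k, v))%:R * (A (enum_val x).1 i (enum_val x).2 / a i)).

Let X := reflect_mx.

Let a_neq0 i : a i != 0. Proof. by rewrite elP. Qed.

(** By the sink condition, the coordinate [el i] occurs only in the image of the i-th basis vector,
    so the relations can be solved independently. *)
Let el_own i j : A (el i).1 j (el i).2 != 0 -> j = i.
Proof. by move/sink_inj; apply; apply: a_neq0. Qed.

Let el_inj : injective el.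
Proof. by move=> i j eij; apply: el_own; rewrite -eij; apply: a_neq0. Qed.

Lemma keptP t : (t \in S) = [forall i, el i != t].
Proof.
rewrite inE; apply/negP/forallP => [nt i|nt /imsetP[i _ ti]].
  by apply/eqP => it; apply: nt; rewrite -it imset_f.
by move: (nt i); rewrite ti eqxx.
Qed.

Let notS i : el i \in S = false.
Proof. by rewrite inE imset_f. Qed.

Lemma card_reflect : (#|S| + p)%N = (m * q)%N.
Proof.
by rewrite -[p in LHS]card_ord -(card_imset _ el_inj) addnC cardsC card_prod !card_ord.
Qed.

Lemma reflect_mx_kept k v x : (k, v) \in S -> X k v x = (enum_val x == (k, v))%:R.
Proof.
rewrite keptP => /forallP kvS; rewrite mxE big1 ?subr0 // => i _.
by rewrite (negPf (kvS i)) mul0r.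
Qed.

Let XE i x :
  X (el i).1 (el i).2 x = - (A (enum_val x).1 i (enum_val x).2 / a i).
Proof.
rewrite mxE -surjective_pairing (bigD1 i) //= eqxx mul1r big1 ?addr0.
  case: eqP => [xi|_]; last by rewrite sub0r.
  by have := enum_valP x; rewrite xi notS.
by move=> j /negPf ji; rewrite (inj_eq el_inj) ji mul0r.
Qed.

Lemma reflect_mx_neq0 k v x : X k v x != 0 ->
  enum_val x = (k, v) \/
  exists i, el i = (k, v) /\ A (enum_val x).1 i (enum_val x).2 != 0.
Proof.
have [kvS|] := boolP ((k, v) \in S).
  by rewrite reflect_mx_kept //; case: (enum_val x =P _) => [|_]; [left | rewrite eqxx].
rewrite inE negbK => /imsetP[i _ kvi].
have -> : k = (el i).1 by rewrite -kvi.
have -> : v = (el i).2 by rewrite -kvi.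
rewrite XE => Ax; right; exists i; split; first exact: surjective_pairing.
by apply: contraNneq Ax => ->; rewrite mul0r oppr0.
Qed.

Let mul_X n (Z : 'I_m -> 'M[F]_(n, q)) i x :
  (\sum_k Z k *m X k) i x = Z (enum_val x).1 i (enum_val x).2
    - \sum_j Z (el j).1 i (el j).2 * (A (enum_val x).1 j (enum_val x).2 / a j).
Proof.
rewrite summxE; under eq_bigr => k _ do rewrite mxE.
rewrite pair_big /=.
transitivity (\sum_(t : 'I_m * 'I_q) (Z t.1 i t.2 * (enum_val x == t)%:R
  - \sum_j Z t.1 i t.2 * (el j == t)%:R * (A (enum_val x).1 j (enum_val x).2 / a j))).
  apply: eq_bigr => -[k v] _ /=; rewrite mxE mulrBr mulr_sumr.
  by congr (_ - _); apply: eq_bigr => j _; rewrite !mulrA.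
rewrite sumrB; congr (_ - _).
  rewrite (bigD1 (enum_val x)) //= eqxx mulr1 big1 ?addr0 // => t.
  by rewrite eq_sym => /negPf->; rewrite mulr0.
rewrite exchange_big; apply: eq_bigr => j _ /=.
rewrite (bigD1 (el j)) //= eqxx mulr1 big1 ?addr0 // => t.
by rewrite eq_sym => /negPf->; rewrite mulr0 mul0r.
Qed.

Lemma reflect_indec : indec_mx A -> indec_mx X.
Proof.
apply: indec_mx_reflect.
- apply/matrixP => i x; rewrite mul_X mxE (bigD1 i) //= big1 => [|j ji].
    by rewrite addr0 mulrCA divff ?mulr1 ?subrr ?a_neq0.
  apply/eqP; rewrite mulf_eq0; apply/orP; left.
  by apply: contraNT ji => /el_own->.
(* The eliminated coordinates of [Z] force the coefficients of a preimage; the vanishing in the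
   cokernel makes the kept coordinates agree. *)
- move=> n Z ZX0; exists (\matrix_(i, j) (Z (el j).1 i (el j).2 / a j)) => k.
  apply/matrixP => i v; rewrite mxE; have [kvS|] := boolP ((k, v) \in S).
    have /matrixP/(_ i (enum_rank_in kvS (k, v))) := ZX0.
    rewrite mul_X enum_rankK_in //= mxE => /eqP; rewrite subr_eq0 => /eqP ->.
    by apply: eq_bigr => j _; rewrite mxE mulrA mulrAC.
  rewrite inE negbK => /imsetP[j _ kvj].
  have -> : k = (el j).1 by rewrite -kvj.
  have -> : v = (el j).2 by rewrite -kvj.
  rewrite (bigD1 j) //= big1 ?addr0 => [|l lj].
    by rewrite mxE divfK ?a_neq0.
  apply/eqP; rewrite mulf_eq0; apply/orP; right.
  by apply: contraNT lj => /el_own->.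
- move=> n U UA; apply/matrixP => i j; rewrite mxE.
  have /matrixP/(_ i (el j).2) := UA (el j).1.
  rewrite !mxE (bigD1 j) //= big1 ?addr0 => [|l lj].
    by move/eqP; rewrite mulf_eq0 (negPf (a_neq0 j)) orbF => /eqP.
  apply/eqP; rewrite mulf_eq0; apply/orP; right.
  by apply: contraNT lj => /el_own->.
(* The rows of the kept pairs form an identity matrix, whence surjectivity. *)
move=> n T XT; apply/matrixP => x i; rewrite mxE.
have xS := enum_valP x; have /matrixP/(_ (enum_val x).2 i) := XT (enum_val x).1.
rewrite !mxE (bigD1 x) //= big1 ?addr0 => [|y yx].
  by rewrite reflect_mx_kept -?surjective_pairing // eqxx mul1r.
rewrite reflect_mx_kept -?surjective_pairing // (inj_eq enum_val_inj) (negPf yx).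
by rewrite mul0r.
Qed.

(** Each kept pair gives one arrow from its unit row, and each old arrow at a kept pair gives at
    most one more. The p arrows [el i] are not among the latter. *)
Lemma nb_arrows_reflect : (nb_arrows X + p <= #|S| + nb_arrows A)%N.
Proof.
have nbA : nb_arrows A = (\sum_i \sum_(t : 'I_m * 'I_q) (A t.1 i t.2 != 0%R))%N.
  by rewrite /nb_arrows exchange_big; apply: eq_bigr => i _; rewrite pair_big.
have nbS : (\sum_(x < #|S|) \sum_i (A (enum_val x).1 i (enum_val x).2 != 0%R) + p
             <= nb_arrows A)%N.
  rewrite exchange_big nbA [Y in (_ + Y <= _)%N](_ : p = \sum_(i < p) 1)%N.
    2: by rewrite sum1_card card_ord.
  rewrite -big_split.
  apply: leq_sum => i _ /=.
  rewrite -(big_enum_val (fun t : 'I_m * 'I_q => (A t.1 i t.2 != 0%R : nat))).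
  rewrite [Y in (_ <= Y)%N](bigID [in S]) /= leq_add2l (bigD1 (el i)) /=.
    by rewrite a_neq0.
  by rewrite notS.
apply: leq_trans (leq_add (leqnn #|S|) nbS); rewrite addnA leq_add2r.
rewrite [Y in (_ <= Y + _)%N](_ : #|S| = \sum_(x < #|S|) 1)%N.
  2: by rewrite sum1_card card_ord.
rewrite -big_split /=.
rewrite /nb_arrows; under eq_bigr => k _ do rewrite exchange_big.
rewrite exchange_big; apply: leq_sum => x _ /=.
rewrite pair_big /=.
have -> : 1%N = (\sum_(t : 'I_m * 'I_q) (enum_val x == t))%N.
  by rewrite (bigD1 (enum_val x)) //= eqxx big1 // => t /negPf; rewrite eq_sym => ->.
have -> : (\sum_i (A (enum_val x).1 i (enum_val x).2 != 0%R)
  = \sum_(t : 'I_m * 'I_q) \sum_i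
      ((el i == t) && (A (enum_val x).1 i (enum_val x).2 != 0%R)))%N.
  rewrite exchange_big; apply: eq_bigr => i _.
  rewrite (bigD1 (el i)) //= eqxx big1 ?addn0 // => t.
  by rewrite eq_sym => /negPf->.
rewrite -big_split /=; apply: leq_sum => -[k v] _ /=.
have [/reflect_mx_neq0|//] := boolP (X k v x != 0).
case=> [->|[i [ei Ai]]]; first by rewrite eqxx.
by rewrite (bigD1 i) //= ei eqxx Ai /= addnCA.
Qed.

End Reflection.

Lemma reflectable_reflect p q (A : 'I_m -> 'M[F]_(p, q)) :
    (3 <= m)%N -> reflectable A -> indec_mx A ->
  exists r (X : 'I_m -> 'M[F]_(q, r)),
    [/\ (r + p)%N = (m * q)%N, reflectable X & indec_mx X].
Proof.
move=> m3 [sink_inj /fin_all_exists[el elP] miss nbA] indA.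
have XN := reflect_mx_neq0 sink_inj elP.
exists _, (reflect_mx A el); split;
  [exact: (card_reflect sink_inj elP) | | exact: (reflect_indec sink_inj elP indA)].
split.
- move=> k v v' x /XN Xv /XN Xv'.
  case: Xv Xv' => [ex|[i [ei Ai]]] [ex'|[i' [ei' Ai']]].
  + by move: ex'; rewrite ex => -[].
  + by move: Ai'; rewrite ex /=; have := elP i' v; rewrite ei' /= => -> /eqP.
  + by move: Ai; rewrite ex' /=; have := elP i v'; rewrite ei /= => -> /eqP.
  + by have := sink_inj _ _ _ _ Ai Ai' => ii'; move: ei'; rewrite -ii' ei => -[].
(* If colour k is missing at v, then [(k, v)] is not eliminated and its row is a unit vector: this
   is the private arrow of the new source v. *)
- move=> v; have [k Ak] := miss v.
  have kvS : (k, v) \in ~: [set el i | i : 'I_p].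
    rewrite keptP; apply/forallP => i; apply: contraTneq isT => ei.
    by have := elP i v; rewrite ei /= eqxx Ak eqxx.
  exists (k, enum_rank_in kvS (k, v)) => x /=.
  rewrite reflect_mx_kept // -(inj_eq enum_val_inj) enum_rankK_in //.
  by case: (enum_val x == _); rewrite ?oner_eq0 ?eqxx.
(* At most two colours enter x: its own, and that of [el i] for the only i with an old arrow at x. A
   third colour remains since m >= 3. *)
- move=> x; set s := enum_val x.
  have [k /andP[ks kA]] : exists k : 'I_m, (k != s.1) &&
      [forall i, (A s.1 i s.2 != 0) ==> (k != (el i).1)].
    case: (pickP (fun i => A s.1 i s.2 != 0)) => [i Ai|A0].
      have [k /andP[k1 k2]] := ord_avoid2 s.1 (el i).1 m3.
      exists k; rewrite k1; apply/forallP => i'; apply/implyP => Ai'.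
      by rewrite (sink_inj _ _ _ _ Ai' Ai).
    have [k /andP[k1 _]] := ord_avoid2 s.1 s.1 m3.
    by exists k; rewrite k1; apply/forallP => i; rewrite A0.
  exists k => v; apply/eqP; apply: contraTT isT => /XN[ex|[i [ei Ai]]].
    by rewrite /s ex eqxx in ks.
  by move/forallP/(_ i)/implyP/(_ Ai): kA; rewrite ei eqxx.
have := nb_arrows_reflect sink_inj elP.
by move: nbA; lia.
Qed.

End ReflectTree.

(** * Caterpillars *)

Lemma nb_arrows_card (F : fieldType) m p q (A : 'I_m -> 'M[F]_(p, q)) :
  nb_arrows A = #|[set t : 'I_m * 'I_p * 'I_q | A t.1.1 t.1.2 t.2 != 0]|.
Proof.
rewrite /nb_arrows !pair_big /= -sum1_card [RHS]big_mkcond /=.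
by apply: eq_bigr => t _; rewrite inE; case: (_ == _).
Qed.

(** An invertible idempotent is the identity; this applies to [Q] if c is nonzero and to [1%:M - Q]
    if c = 0. *)
Lemma trig_idempotent (F : fieldType) n (Q : 'M[F]_n) c :
    (forall i j : 'I_n, (j < i)%N -> Q i j = 0) -> (forall i, Q i i = c) ->
    Q *m Q = Q ->
  Q = if c == 0 then 0 else 1%:M.
Proof.
move=> trigQ diagQ QQ; case: eqP => [c0|/eqP c0].
  have : 1%:M - Q \in unitmx.
    rewrite unitmxE -det_tr det_trig; last first.
      apply/is_trig_mxP => i j ij; rewrite !mxE trigQ // subr0.
      by rewrite -val_eqE /= gtn_eqF.
    by rewrite big1 ?unitr1 // => i _; rewrite !mxE eqxx diagQ c0 subr0.
  by move=> U; rewrite -[LHS](mulKmx U) mulmxBl mul1mx QQ subrr mulmx0.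
have : Q \in unitmx.
  rewrite unitmxE -det_tr det_trig; last first.
    by apply/is_trig_mxP => i j ij; rewrite mxE trigQ.
  under eq_bigr => i _ do rewrite mxE diagQ.
  by rewrite prodr_const unitfE expf_neq0.
by move=> U; rewrite -[LHS](mulKmx U) QQ mulVmx.
Qed.

Section Caterpillar.
Variables (F : fieldType) (m d e : nat) (s : nat -> nat).
Hypothesis m3 : (3 <= m)%N.
Hypothesis s0 : s 0 = 0%N.
Hypothesis s_lt : forall w, (s w < s w.+1)%N.
Hypothesis s_le : forall w, (s w.+1 <= s w + m.-1)%N.
Hypothesis s_lt_e : forall w : 'I_d, (s w < e)%N.
Hypothesis e_le_s : (e <= s d)%N.
Hypothesis d_gt0 : (0 < d)%N.

(* Source w is joined to the sinks s w, ..., s (w + 1), the arrow to s w + c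
   having colour c; consecutive sources share one sink. *)
Definition caterpillar (c : 'I_m) : 'M[F]_(d, e) :=
  \matrix_(w, v) ((v == (s w + c)%N :> nat) && (v <= s w.+1)%N)%:R.

Let A := caterpillar.

Let A_neq0 c w v : (A c w v != 0) = (v == (s w + c)%N :> nat) && (v <= s w.+1)%N.
Proof. by rewrite mxE; case: (_ && _); rewrite ?oner_eq0 ?eqxx. Qed.

Let s_mono : {mono s : x y / (x <= y)%N}.
Proof. by apply: leq_mono; apply: homo_ltn => //; apply: ltn_trans. Qed.

Let s_mono_lt : {mono s : x y / (x < y)%N}.
Proof. exact: leqW_mono. Qed.

Let s_inj : injective s.
Proof.
by move=> x y xy; apply/eqP; rewrite eqn_leq -(s_mono x y) -(s_mono y x) xy leqnn.
Qed.

(** Every sink but 0 hangs from one source by an arrow of nonzero colour; arrows of colour 0 lead to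
    the joints s w. *)
Let locate (v : 'I_e) : (0 < v)%N -> exists w : 'I_d, (s w < v <= s w.+1)%N.
Proof.
move=> v0; have ex_n : exists n, (v <= s n)%N.
  by exists d; apply: leq_trans (ltnW (ltn_ord v)) e_le_s.
case: (ex_minnP ex_n) => -[|w]; first by rewrite s0; lia.
move=> vw minw; have w_d : (w < d)%N.
  by apply: minw; apply: leq_trans (ltnW (ltn_ord v)) e_le_s.
exists (Ordinal w_d); rewrite vw andbT ltnNge.
by apply/negP => /minw; rewrite ltnn.
Qed.

Let locate_uniq v w w' : (s w < v <= s w.+1)%N -> (s w' < v <= s w'.+1)%N -> w = w'.
Proof.
move=> /andP[wv vw] /andP[w'v vw'].
have ww' : (w < w'.+1)%N by rewrite -s_mono_lt; lia.
have w'w : (w' < w.+1)%N by rewrite -s_mono_lt; lia.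
by lia.
Qed.

Let o : 'I_m := Ordinal (leq_trans (isT : (0 < 3)%N) m3).
Let z : 'I_e := Ordinal (leq_trans (ltn0Sn _) (s_lt_e (Ordinal d_gt0))).
Let joint w : 'I_e := Ordinal (s_lt_e w).

Let A_o w v : (A o w v != 0) = (v == joint w).
Proof. by rewrite A_neq0 addn0 -val_eqE /=; case: eqP => //= ->; rewrite ltnW. Qed.

Lemma caterpillar_reflectable : reflectable A.
Proof.
split.
- move=> c w w' v; rewrite !A_neq0 => /andP[/eqP vw _] /andP[/eqP vw' _].
  by apply/ord_inj/s_inj; lia.
- by move=> w; exists (o, joint w) => v; rewrite A_o.
(* Sink 0 admits only colour 0. Any other sink admits at most colour 0 and the colour of the arrow
   from which it hangs. *)
- move=> v; have [v0|v0] := posnP v.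
    have [c /andP[co _]] := ord_avoid2 o o m3.
    exists c => w; apply/eqP; apply: contraNT co; rewrite A_neq0.
    by case/andP=> /eqP vw _; apply/eqP/val_inj => /=; lia.
  have [w /andP[wv vw]] := locate v0.
  have v_m : (v - s w < m)%N by have := s_le w; lia.
  have [c /andP[co cv]] := ord_avoid2 o (Ordinal v_m) m3.
  exists c => w'; apply/eqP; apply: contraNT cv; rewrite A_neq0.
  case/andP=> /eqP vw' v_le; apply/eqP/val_inj => /=.
  have c0 : (0 < c)%N by rewrite lt0n.
  have -> : w = w' :> nat by apply: (locate_uniq (v := v)); lia.
  by lia.
(* With sink 0 as root, each arrow is charged to its endpoint farther from the root: the source for
   colour 0, the sink otherwise. The root itself is never charged. *)
- rewrite nb_arrows_card; set E := [set t | _].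
  pose h (t : 'I_m * 'I_d * 'I_e) : 'I_d + 'I_e :=
    if t.1.1 == o then inl t.1.2 else inr t.2.
  have inj_h : {in E &, injective h}.
    move=> [[c w] v] [[c' w'] v']; rewrite !inE !A_neq0 /h /=.
    case/andP=> /eqP vw v_le /andP[/eqP vw' v_le'].
    case: eqP => [co|/eqP co]; case: eqP => [co'|/eqP co'] //.
      case=> ww'; rewrite -ww' co co' in vw vw' *; congr (_, _, _).
      by apply: val_inj; rewrite /= vw vw'.
    case=> vv'; rewrite -vv' in vw' v_le' *.
    have c0 : (0 < c)%N by rewrite lt0n.
    have c'0 : (0 < c')%N by rewrite lt0n.
    have ww' : w = w' by apply/ord_inj/(locate_uniq (v := v)); lia.
    by rewrite -ww' in vw' *; congr (_, _, _); apply: val_inj => /=; lia.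
  rewrite -(card_in_imset inj_h).
  have /subset_leq_card : h @: E \subset [set~ inr z].
    apply/subsetP => _ /imsetP[[[c w] v] tE ->]; move: tE; rewrite !inE A_neq0 /h /=.
    case/andP=> /eqP vw _; case: (c =P o) => // /eqP co; apply/eqP => -[vz].
    have c0 : (0 < c)%N by rewrite lt0n.
    by have /(congr1 val) /= := vz; lia.
  by rewrite cardsC1 card_sum !card_ord; have := d_gt0; lia.
Qed.

(** Commutation with colour 0 makes [P] the restriction of [Q] to the joints. Commutation with the
    other colours expresses each row of [Q] by the row of an earlier joint, so everything is
    propagated from sink 0. *)
Lemma caterpillar_indec : indec_mx A.
Proof.
split=> [|P Q PP QQ PA]; first by rewrite addn_gt0 d_gt0.
have QE (c : 'I_m) (w : 'I_d) (v0 v : 'I_e) :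
    v0 = (s w + c)%N :> nat -> (v0 <= s w.+1)%N ->
    Q v0 v = \sum_w' P w w' * A c w' v.
  move=> v0E v0_le; have /matrixP/(_ w v) := PA c.
  rewrite !mxE => ->; rewrite (bigD1 v0) //= big1 ?addr0 => [|v' v'v0].
    by rewrite mxE v0E eqxx -v0E v0_le mul1r.
  by rewrite mxE -v0E val_eqE (negPf v'v0) mul0r.
have PE w w' : P w w' = Q (joint w) (joint w').
  rewrite (QE o w) ?addn0 //; last by rewrite /= ltnW ?s_lt.
  rewrite (bigD1 w') //= big1 ?addr0 => [|w2 w2w'].
    by rewrite mxE addn0 eqxx /= ltnW ?s_lt ?mulr1.
  by rewrite mxE addn0 /= (inj_eq s_inj) eq_sym val_eqE (negPf w2w') mulr0.
(* Q is upper triangular with constant diagonal, hence so is P. *)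
have Q_trig n (v0 : 'I_e) : (v0 < n)%N ->
    (forall v : 'I_e, (v < v0)%N -> Q v0 v = 0) /\ Q v0 v0 = Q z z.
  elim: n v0 => // n IH v0 v0n; have [v00|v0_gt0] := posnP v0.
    split=> [v|]; first by rewrite v00.
    by have -> : v0 = z by apply: val_inj.
  have [w /andP[wv vw]] := locate v0_gt0.
  have v_m : (v0 - s w < m)%N by have := s_le w; lia.
  have [c v0E] : exists c : 'I_m, v0 = (s w + c)%N :> nat.
    by exists (Ordinal v_m); rewrite /= subnKC // ltnW.
  have [IH0 IH1] := IH (joint w) (leq_trans wv v0n).
  split=> [v v_v0|]; rewrite (QE _ _ _ _ v0E vw).
    rewrite big1 // => w' _; rewrite mxE.
    case: andP => [[/eqP vw' _]|]; last by rewrite mulr0.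
    by rewrite PE IH0 ?mul0r //=; lia.
  rewrite (bigD1 w) //= big1 ?addr0 => [|w' w'w].
    by rewrite mxE -v0E eqxx vw mulr1 PE.
  rewrite mxE v0E eqn_add2r (inj_eq s_inj) eq_sym val_eqE (negPf w'w).
  by rewrite mulr0.
have P_E : P = if Q z z == 0 then 0 else 1%:M.
  apply: trig_idempotent => // [w w' ww'|w]; rewrite PE.
    have [Q0 _] := Q_trig _ (joint w) (ltnSn _); apply: Q0.
    by rewrite /= s_mono_lt.
  by have [_] := Q_trig _ (joint w) (ltnSn _).
have Q_E : Q = if Q z z == 0 then 0 else 1%:M.
  apply: trig_idempotent => // [v v' vv'|v].
    by have [Q0 _] := Q_trig _ v (ltnSn _); apply: Q0.
  by have [_] := Q_trig _ v (ltnSn _).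
by case: (Q z z == 0) P_E Q_E => -> ->; [left | right].
Qed.

End Caterpillar.

(** * Existence *)

Section Existence.
Variables (F : fieldType) (m : nat).

Lemma indec_mx_dim0 e (A : 'I_m -> 'M[F]_(0, e)) : indec_mx A -> e = 1%N.
Proof.
case; rewrite add0n => e0 indA; pose o := Ordinal e0.
have [||k|[_]|[_]] := indA 0 (delta_mx o o).
- exact: flatmx0.
- by rewrite mul_delta_mx.
- by rewrite [LHS]flatmx0 [RHS]flatmx0.
- by move/matrixP/(_ o o)/eqP; rewrite !mxE !eqxx oner_eq0.
move/matrixP => D1; apply/eqP; rewrite eqn_leq e0 andbT leqNgt; apply/negP => e1.
by have /eqP := D1 (Ordinal e1) (Ordinal e1); rewrite !mxE eqxx eq_sym oner_eq0.
Qed.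

Lemma simple_reflectable : (3 <= m)%N ->
  exists A : 'I_m -> 'M[F]_(0, 1), reflectable A /\ indec_mx A.
Proof.
move=> m3; exists (fun=> 0); split; split=> //.
- by move=> k [].
- by case.
- by move=> j; exists (Ordinal (leq_trans (isT : (0 < 3)%N) m3)); case.
- by rewrite /nb_arrows big1 // => k _; rewrite big_ord0.
move=> P Q _ QQ _; rewrite [P]flatmx0 [Q]mx11_scalar.
have /eqP : Q 0 0 * Q 0 0 = Q 0 0.
  by rewrite -[RHS](congr1 (fun B : 'M_1 => B 0 0) QQ) mxE big_ord1.
rewrite -{3}[Q 0 0]mulr1 -subr_eq0 -mulrBr mulf_eq0 subr_eq0.
case/orP=> /eqP->; [left | right]; split=> //; last by rewrite [RHS]flatmx0.
exact: raddf0.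
Qed.

Lemma thin_reflectable d e : (3 <= m)%N -> (0 < d <= e)%N -> (e <= d * m.-1)%N ->
  exists A : 'I_m -> 'M[F]_(d, e), reflectable A /\ indec_mx A.
Proof.
(* The minimum of two progressions with steps m - 1 and 1 has all its steps between these bounds;
   the second progression stays below e for w < d, and s d = e. *)
move=> m3 /andP[d0 de] e_le; pose s w := minn (w * m.-1) (e - d + w).
have s0 : s 0 = 0%N by rewrite /s min0n.
have s_lt w : (s w < s w.+1)%N by rewrite /s mulSn; lia.
have s_le w : (s w.+1 <= s w + m.-1)%N by rewrite /s mulSn; lia.
have s_lt_e (w : 'I_d) : (s w < e)%N by rewrite /s; have := ltn_ord w; lia.
have e_le_s : (e <= s d)%N by rewrite /s leq_min e_le subnK ?leqnn.
exists (caterpillar F d e s); split.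
  exact: (caterpillar_reflectable F m3 s0 s_lt s_le s_lt_e e_le_s d0).
exact: (caterpillar_indec F m3 s0 s_lt s_le s_lt_e e_le_s d0).
Qed.

Lemma exists_reflectable d e (B : 'I_m -> 'M[F]_(d, e)) :
    (3 <= m)%N -> (d <= e)%N -> indec_mx B ->
  exists A : 'I_m -> 'M[F]_(d, e), reflectable A /\ indec_mx A.
Proof.
move=> m3; have [n] := ubnP (d + e); elim: n d e B => // n IH d e B den de indB.
have [d0|d0] := posnP d.
  move: B indB; rewrite d0 => B /indec_mx_dim0->; exact: simple_reflectable.
have [e_le|e_gt] := leqP e (d * m.-1); first by apply: thin_reflectable; rewrite ?d0.
(* Here p = md - e < d. The given [B] serves to supply an indecomposable of the smaller dimension
   vector (p, d). *)
have [p [Y [pe indY]]] := indec_mx_descend d0 indB.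
have pd : (p < d)%N.
  have : (m * d = d * m.-1 + d)%N by rewrite -mulnSr prednK 1?mulnC //; lia.
  by lia.
have [A [reflA indA]] := IH p d Y ltac:(lia) (ltnW pd) indY.
have [r [X [rp reflX indX]]] := reflectable_reflect m3 reflA indA.
by have -> : e = r by [lia]; exists X.
Qed.

(** For d > e the transpose is used. The colour conditions distinguish sources from sinks, so only
    the bound on the number of arrows is carried over. *)
Lemma exists_tree_like d e (B : 'I_m -> 'M[F]_(d, e)) :
    (3 <= m)%N -> indec_mx B ->
  exists A : 'I_m -> 'M[F]_(d, e), indec_mx A /\ (nb_arrows A < d + e)%N.
Proof.
move=> m3 indB; have [de|/ltnW ed] := leqP d e.
  by have [A [[_ _ _ nbA] indA]] := exists_reflectable m3 de indB; exists A.
have [A [[_ _ _ nbA] indA]] := exists_reflectable m3 ed (indec_mx_tr indB).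
exists (fun k => (A k)^T); split; first exact: indec_mx_tr.
rewrite addnC; apply: leq_ltn_trans nbA; rewrite /nb_arrows.
apply: leq_sum => k _; rewrite exchange_big; apply: leq_sum => i _.
by apply: leq_sum => j _; rewrite mxE.
Qed.

(** * Coefficient quivers in the standard bases *)

Definition rV_basis n : n.-tuple 'rV[F]_n := mktuple (fun i => delta_mx 0 i).

Lemma sum_rV_basis n (k : 'I_n -> F) : \sum_i k i *: (rV_basis n)`_i = \row_i k i.
Proof.
rewrite [RHS]row_sum_delta; apply: eq_bigr => i _.
by rewrite mxE -tnth_nth tnth_mktuple.
Qed.

Lemma free_rV_basis n : free (rV_basis n).
Proof.
apply/freeP => k; rewrite sum_rV_basis => /rowP k0 i.
by have := k0 i; rewrite !mxE.
Qed.

Lemma rV_basis_full n : basis_of fullv (rV_basis n).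
Proof. by rewrite basisEfree free_rV_basis subvf size_tuple dimv_rV leqnn. Qed.

Lemma coord_rV_basis n i (v : 'rV[F]_n) : coord (rV_basis n) i v = v 0 i.
Proof.
rewrite [v in LHS]row_sum_delta.
under eq_bigr => j _ do rewrite -(tnth_mktuple (fun i => delta_mx 0 i) j) (tnth_nth 0).
by rewrite coord_sum_free ?free_rV_basis.
Qed.

(** With p and q as variables, the lengths of the bases can be replaced by the dimensions required
    in [tree_module] without casts. *)
Lemma tree_moduleI (X : kronecker_rep F m) p q
    (B1 : p.-tuple (rep1 X)) (B2 : q.-tuple (rep2 X)) :
  basis_of fullv B1 -> basis_of fullv B2 -> is_tree (coefficient_quiver B1 B2) ->
  tree_module X.
Proof.
move=> b1 b2; have dp := size_basis b1; have dq := size_basis b2.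
by subst p q => treeB; exists B1, B2.
Qed.

Section CoefficientTree.
Variables (p q : nat) (A : 'I_m -> 'M[F]_(p, q)).
Hypothesis indA : indec_mx A.
Let Q := @coefficient_quiver F m (mx_rep A) p q (rV_basis p) (rV_basis q).

Let coefE k i j :
  coord (rV_basis q) j (repmap (mx_rep A) k (tnth (rV_basis p) i)) = A k i j.
Proof. by rewrite coord_rV_basis tnth_mktuple repmap_mx_rep -rowE mxE. Qed.

Lemma coefficient_quiver_connected : graph_connected Q.
Proof.
case: indA => pq0 ind; split; first by rewrite card_sum !card_ord.
move=> x y; pose C : pred ('I_p + 'I_q) := connect (@adjacent Q) x.
have C_adj k i j : A k i j != 0 -> C (inl i) = C (inr j).
  move=> Akij; have ij : @adjacent Q (inl i) (inr j).
    have tP : @nonzero_coef F m (mx_rep A) p q (rV_basis p) (rV_basis q) (k, i, j).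
      by rewrite /= coefE.
    apply/existsP; exists (exist _ (k, i, j) tP).
    by rewrite /joins /= !eqxx.
  apply/idP/idP => /connect_trans; apply; apply: connect1 => //.
  by rewrite adjacent_sym.
(* The coordinate projection onto the connected component of x is an idempotent endomorphism. It is
   nonzero at x, hence the identity, so y lies in that component. *)
pose D n (c : 'I_n -> bool) : 'M[F]_n := diag_mx (\row_i (c i)%:R).
have DD n (c : 'I_n -> bool) : D n c *m D n c = D n c.
  rewrite mulmx_diag; congr diag_mx; apply/rowP => i; rewrite !mxE.
  by case: (c i); rewrite ?mulr0 ?mulr1.
have [] := ind _ _ (DD _ (fun i => C (inl i))) (DD _ (fun j => C (inr j))).
- move=> k; rewrite mul_diag_mx mul_mx_diag; apply/matrixP => i j; rewrite !mxE.
  by have [->|/C_adj->] := eqVneq (A k i j) 0; rewrite ?mul0r ?mulr0 // mulrC.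
- case=> P0 Q0; have := connect0 (@adjacent Q) x; rewrite -/(C x).
  case: x @C C_adj P0 Q0 => [i|j] C _ P0 Q0 Cx.
    by have /matrixP/(_ i i)/eqP := P0; rewrite !mxE eqxx Cx oner_eq0.
  by have /matrixP/(_ j j)/eqP := Q0; rewrite !mxE eqxx Cx oner_eq0.
case=> P1 Q1; rewrite -/(C y); case: y => [i|j].
  have /matrixP/(_ i i)/eqP := P1; rewrite !mxE eqxx.
  by case: (C _) => //; rewrite eq_sym oner_eq0.
have /matrixP/(_ j j)/eqP := Q1; rewrite !mxE eqxx.
by case: (C _) => //; rewrite eq_sym oner_eq0.
Qed.

Lemma mx_rep_tree_module : (nb_arrows A < p + q)%N -> tree_module (mx_rep A).
Proof.
move=> nbA; have treeQ : is_tree Q.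
  apply: is_tree_card_arrows; first exact: coefficient_quiver_connected.
  rewrite card_sum !card_ord; apply: leq_ltn_trans nbA.
  rewrite nb_arrows_card card_sig; apply: subset_leq_card.
  by apply/subsetP => -[[k i] j]; rewrite !inE /= coefE.
exact: (@tree_moduleI (mx_rep A) p q) (rV_basis_full p) (rV_basis_full q) treeQ.
Qed.

End CoefficientTree.

End Existence.

Theorem theorem3p8 (R : realType) (m : nat) (hm : (3 <= m)%N) (d e : nat)
    (hroot : is_root R[i] m d e) (hgcd : gcdn d e = 1%N) :
  exists X : kronecker_rep R[i] m,
    [/\ indecomposable X, tree_module X & has_dimension_vector X d e].
Proof.
case: hroot => X [/indecomposable_indec_mx[B]] indB [dimV dimW].
have [A [indA nbA]] := exists_tree_like hm indB.
exists (mx_rep A); split; first exact: mx_rep_indecomposable.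
  exact: mx_rep_tree_module.
by split; rewrite dimv_rV.
Qed.
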